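(* Each of the following implications is valid, and in each case the reverse implication is not valid: 1. ${\sim}\neg p\rightarrow p$; 2. $p\rightarrow\neg\neg p$; 3. $\neg\neg p\rightarrow\neg\neg{\sim}{\sim}p$; 4. $\neg\neg{\sim}{\sim}p\rightarrow\neg{\sim}p$; 5. $\neg{\sim}p\rightarrow{\sim}{\sim}\neg\neg p$; 6. ${\sim}\neg p\rightarrow\neg{\sim}{\sim}\neg p$; 7. $\neg{\sim}{\sim}\neg p\rightarrow\neg\neg p$; 8. $p\rightarrow{\sim}{\sim}p$; 9. ${\sim}{\sim}p\rightarrow\neg\neg{\sim}{\sim}p$.
   Context: Fix one propositional variable $p$. The n-formulae (monadic purely negational fragment of Intuitionistic Control Logic) are the formulae built from $p$ using only two primitive unary connectives ${\sim}$ (intuitionistic negation) and $\neg$ ($\perp$-negation). A Kripke r-model is $\langle W,\mathbf r,\leq,\Vdash\rangle$ where $W$ is a finite non-empty set (of worlds), $\leq$ is a reflexive and transitive relation on $W$, $\mathbf r\in W$ (the root) is the least element ($\mathbf r\leq u$ for all $u\in W$), and $\Vdash$ is a forcing relation between worlds and $p$ that is monotone: $u\leq v$ and $u\Vdash p$ imply $v\Vdash p$. We write $w>\mathbf r$ when $w$ is a world properly above the root, i.e. a world other than the root. Forcing is extended to n-formulae by: $u\Vdash {\sim}A$ iff for all $w\geq u$, $w\not\Vdash A$; $u\Vdash \neg A$ iff for all $w\geq u$, $w\not\Vdash A$ or $w>\mathbf r$. For n-formulae $A,B$: $u\Vdash A\rightarrow B$ iff for all $v\geq u$, $v\Vdash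 A$ implies $v\Vdash B$. A formula is valid if it is forced at every world of every r-model. *)

(* Defs.v *)
From mathcomp Require Import all_boot.
Set Implicit Arguments.
Unset Strict Implicit.
Unset Printing Implicit Defensive.

(* ineg is intuitionistic negation (~), bneg is bottom-negation (¬). *)
Inductive nformula : Type :=
| var_p
| ineg of nformula
| bneg of nformula.

(* The order is only a preorder: worlds other than the root may lie below it. *)
Record rmodel : Type := RModel {
  world :> finType;
  root : world;
  le : rel world;
  forces_p : pred world;
  le_refl : reflexive le;
  le_trans : transitive le;
  root_least : forall u, le root u;
  forces_p_monotone : forall u v, le u v -> forces_p u -> forces_p v
}.

Arguments root : clear implicits.
Arguments le {M} u v : rename.
Arguments forces_p {M} u : rename.

(* "w > root" means that w is distinct from the root, even if le w root. *)
Fixpoint forces (M : rmodel) (u : M) (A : nformula) : bool :=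
  match A with
  | var_p => forces_p u
  | ineg B => [forall w : M, le u w ==> ~~ forces w B]
  | bneg B => [forall w : M, le u w ==> (~~ forces w B || (w != root M))]
  end.

(* Implication is not a connective of n-formulae; it only occurs outermost. *)
Definition forces_imp (M : rmodel) (u : M) (A B : nformula) : bool :=
  [forall v : M, le u v ==> (forces v A ==> forces v B)].

Definition valid_imp (A B : nformula) : Prop :=
  forall (M : rmodel) (u : M), forces_imp u A B.

Definition strictly_implies (A B : nformula) : Prop :=
  valid_imp A B /\ ~ valid_imp B A.

(* Main.v *)
Require Import Defs.
From mathcomp Require Import all_boot.
Set Implicit Arguments.
Unset Strict Implicit.
Unset Printing Implicit Defensive.

(** Since the root lies below every world, [bneg A] only ever inspects the root:
    a world [u] forces it iff [u] is not below the root or the root does not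
    force [A] ([forces_bneg]).  So above the root's equivalence class [bneg] is
    trivially true, and inside that class it is classical negation of the value
    of [A] at the root.

    For validity, a few facts about arbitrary formulae then suffice: [bneg]
    reverses valid implications, [A] implies both of its double negations, [ineg A] implies [bneg A],
    [ineg (bneg A)] implies [A], and [bneg (ineg A)] implies
    [ineg (ineg (bneg (bneg A)))].  The other implications come from
    contraposing and composing these.

    For strictness, two shapes of model are enough.  A root with one world above
    it exploits the triviality of [bneg] at the upper world.  The converse of
    the fourth implication, from [bneg (ineg p)] to
    [bneg (bneg (ineg (ineg p)))], needs a fork: in a chain, if the root
    does not force [ineg p], then the top forces [p], and so the root already
    forces [ineg (ineg p)]. *)

Lemma forces_inegP (M : rmodel) (u : M) A :
  reflect (forall w, le u w -> ~ forces w A) (forces u (ineg A)).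
Proof.
apply: (iffP forallP) => [H w uw | H w]; first exact/negP/(implyP (H w)).
by apply/implyP => uw; apply/negP/H.
Qed.

Lemma forces_bneg (M : rmodel) (u : M) A :
  forces u (bneg A) = (le u (Defs.root M) ==> ~~ forces (Defs.root M) A).
Proof.
apply/forallP/implyP => [H ur | H w].
  by have /implyP/(_ ur) := H (Defs.root M); rewrite eqxx orbF.
apply/implyP => uw; case: eqP => [wr|]; last by rewrite orbT.
by rewrite wr in uw *; rewrite H.
Qed.

Lemma forces_mono (M : rmodel) (u v : M) A :
  le u v -> forces u A -> forces v A.
Proof.
move=> uv; case: A => [|A|A]; first exact: forces_p_monotone.
  by move=> /forces_inegP H; apply/forces_inegP => w /(le_trans uv); apply: H.
rewrite !forces_bneg => /implyP H; apply/implyP => vr.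
exact/H/(le_trans uv).
Qed.

Lemma valid_impP A B :
  valid_imp A B <-> forall (M : rmodel) (u : M), forces u A -> forces u B.
Proof.
split=> H M u.
  by have /forallP/(_ u) := H M u; rewrite le_refl /= => /implyP.
by apply/forallP => v; apply/implyP => _; apply/implyP/H.
Qed.

Lemma valid_imp_trans A B C : valid_imp A B -> valid_imp B C -> valid_imp A C.
Proof. by move=> /valid_impP AB /valid_impP BC; apply/valid_impP => M u /AB/BC. Qed.

Lemma bneg_antitone A B : valid_imp A B -> valid_imp (bneg B) (bneg A).
Proof.
move=> /valid_impP AB; apply/valid_impP => M u; rewrite !forces_bneg.
by move=> /implyP H; apply/implyP => /H; apply/contra/AB.
Qed.

Lemma imp_ineg_ineg A : valid_imp A (ineg (ineg A)).
Proof.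
apply/valid_impP => M u uA; apply/forces_inegP => w uw /forces_inegP/(_ w).
by apply; [exact: le_refl | exact: forces_mono uA].
Qed.

(** A world below the root that forces [A] passes it on to the root by
    monotonicity, where [bneg] is classical. *)
Lemma imp_bneg_bneg A : valid_imp A (bneg (bneg A)).
Proof.
apply/valid_impP => M u uA; rewrite !forces_bneg le_refl /= negbK.
by apply/implyP => ur; apply: forces_mono uA.
Qed.

Lemma ineg_imp_bneg A : valid_imp (ineg A) (bneg A).
Proof.
apply/valid_impP => M u /forces_inegP H; rewrite forces_bneg.
by apply/implyP => /H/negP.
Qed.

(** A world refuting [bneg A] must lie below the root, and the root must force
    [A]; as the root is also below that world, [A] holds there. *)
Lemma ineg_bneg_imp A : valid_imp (ineg (bneg A)) A.
Proof.
apply/valid_impP => M u /forces_inegP/(_ u (le_refl u))/negP.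
rewrite forces_bneg negb_imply negbK => /andP[_].
exact/forces_mono/root_least.
Qed.

(** A world not below the root forces [bneg (bneg A)] trivially.  For a world
    below the root, the failure of [ineg A] at the root provides a world forcing
    [A], hence [bneg (bneg A)], and it lies above everything in the root's
    class. *)
Lemma bneg_ineg_imp A : valid_imp (bneg (ineg A)) (ineg (ineg (bneg (bneg A)))).
Proof.
apply/valid_impP => M u; rewrite forces_bneg => /implyP rnA.
apply/forces_inegP => v uv /forces_inegP nvA.
have vr : le v (Defs.root M).
  by apply: contraT => vr; case: (nvA v (le_refl v)); rewrite forces_bneg (negPf vr).
case/negP: (rnA (le_trans uv vr)); apply/forces_inegP => w rw wA.
apply: (nvA w (le_trans vr rw)).
exact: (proj1 (valid_impP _ _) (imp_bneg_bneg A)).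
Qed.

Lemma ineg_imp_bneg_ineg_ineg A : valid_imp (ineg A) (bneg (ineg (ineg A))).
Proof. exact: valid_imp_trans (imp_ineg_ineg _) (ineg_imp_bneg _). Qed.

Lemma not_valid_imp A B (M : rmodel) (u : M) :
  forces u A && ~~ forces u B -> ~ valid_imp A B.
Proof. by move=> /andP[uA /negP nuB] /valid_impP/(_ M u uA). Qed.

Section Chain.

Variables lo hi : bool.

(** Taking [lo || hi] at the upper world keeps the valuation monotone for all
    values of the parameters. *)
Let chain_p (b : bool) := lo || (b && hi).

Fact chain_refl : reflexive implb. Proof. by case. Qed.
Fact chain_trans : transitive implb. Proof. by do 3!case. Qed.
Fact chain_least b : false ==> b. Proof. by []. Qed.
Fact chain_mono (a b : bool) : a ==> b -> chain_p a -> chain_p b.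
Proof. by rewrite /chain_p; case: a b lo hi => [] [] [] []. Qed.

Definition chain :=
  RModel chain_refl chain_trans chain_least chain_mono.

End Chain.

Definition fork_le (u v : option bool) := (u == None) || (u == v).
Definition fork_p (u : option bool) := u == Some true.

Fact fork_refl : reflexive fork_le.
Proof. by move=> u; rewrite /fork_le eqxx orbT. Qed.
Fact fork_trans : transitive fork_le.
Proof. by move=> [[]|] [[]|] [[]|]. Qed.
Fact fork_least u : fork_le None u. Proof. by []. Qed.
Fact fork_mono u v : fork_le u v -> fork_p u -> fork_p v.
Proof. by move: u v => [[]|] [[]|]. Qed.

Definition fork := RModel fork_refl fork_trans fork_least fork_mono.

(** Quantification over a finite type does not reduce by computation; writing out
    the quantifiers of [ineg] world by world makes forcing in the two models
    a closed boolean expression. *)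
Lemma forall_bool (P : pred bool) : [forall b, P b] = P false && P true.
Proof.
by apply/forallP/andP => [H | [Pf Pt] []].
Qed.

Lemma chain_ineg lo hi (u : chain lo hi) A :
  forces u (ineg A) =
    (u || ~~ forces (false : chain lo hi) A) && ~~ forces (true : chain lo hi) A.
Proof. by rewrite [LHS](forall_bool _) /=; case: u. Qed.

Lemma fork_ineg (u : fork) A :
  forces u (ineg A) =
    [&& fork_le u None ==> ~~ forces (None : fork) A,
        fork_le u (Some false) ==> ~~ forces (Some false : fork) A &
        fork_le u (Some true) ==> ~~ forces (Some true : fork) A].
Proof.
by apply/forallP/and3P => [H | [H0 Hf Ht] [[]|]].
Qed.

Theorem theorem20 :
  strictly_implies (ineg (bneg var_p)) var_p /\
  strictly_implies var_p (bneg (bneg var_p)) /\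
  strictly_implies (bneg (bneg var_p)) (bneg (bneg (ineg (ineg var_p)))) /\
  strictly_implies (bneg (bneg (ineg (ineg var_p)))) (bneg (ineg var_p)) /\
  strictly_implies (bneg (ineg var_p)) (ineg (ineg (bneg (bneg var_p)))) /\
  strictly_implies (ineg (bneg var_p)) (bneg (ineg (ineg (bneg var_p)))) /\
  strictly_implies (bneg (ineg (ineg (bneg var_p)))) (bneg (bneg var_p)) /\
  strictly_implies var_p (ineg (ineg var_p)) /\
  strictly_implies (ineg (ineg var_p)) (bneg (bneg (ineg (ineg var_p)))).
Proof.
pose empty := chain false false.
pose top := chain false true.
pose full := chain true true.
do !split.
- exact: ineg_bneg_imp.
- by apply: (@not_valid_imp _ _ full true); rewrite !(chain_ineg, forces_bneg).
- exact: imp_bneg_bneg.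
- by apply: (@not_valid_imp _ _ empty true); rewrite !(chain_ineg, forces_bneg).
- exact/bneg_antitone/bneg_antitone/imp_ineg_ineg.
- by apply: (@not_valid_imp _ _ top false); rewrite !(chain_ineg, forces_bneg).
- exact/bneg_antitone/ineg_imp_bneg_ineg_ineg.
- by apply: (@not_valid_imp _ _ fork None); rewrite !(fork_ineg, forces_bneg).
- exact: bneg_ineg_imp.
- by apply: (@not_valid_imp _ _ empty false); rewrite !(chain_ineg, forces_bneg).
- exact: ineg_imp_bneg_ineg_ineg.
- by apply: (@not_valid_imp _ _ empty true); rewrite !(chain_ineg, forces_bneg).
- exact/bneg_antitone/imp_ineg_ineg.
- by apply: (@not_valid_imp _ _ full false); rewrite !(chain_ineg, forces_bneg).
- exact: imp_ineg_ineg.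
- by apply: (@not_valid_imp _ _ top false); rewrite !(chain_ineg, forces_bneg).
- exact: imp_bneg_bneg.
- by apply: (@not_valid_imp _ _ empty true); rewrite !(chain_ineg, forces_bneg).
Qed.
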